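(* For $n\ge2$, $$\sum_{\pi\in\mathrm{PF}(n)}x^{\mathrm{lel}(\pi)}y^{\mathrm{one}(\pi)}z^{\mathrm{unl}(\pi)}=xy\Big((n-1)\prod_{i=1}^{n-2}\big(xz+yz+(i-1)z+n-i\big)+(xyz+1)\prod_{i=1}^{n-2}\big(xyz+iz+n-i\big)\Big).$$
   Context: $\mathrm{PF}(n)$ is the set of parking functions of length $n$: sequences $\pi=(\pi_1,\dots,\pi_n)$ of positive integers whose increasing rearrangement $b_1\le\dots\le b_n$ satisfies $b_i\le i$. Equivalently, under the classical protocol (cars $1,\dots,n$ arrive in order, car $i$ parks in the first unoccupied spot among $\pi_i,\pi_i+1,\dots,n$) all cars park. $\mathrm{unl}(\pi)$ is the number of cars not parking in their preferred spot, $\mathrm{lel}(\pi)=\#\{i:\pi_i=\pi_1\}$, $\mathrm{one}(\pi)=\#\{i:\pi_i=1\}$. *)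

(* Defs.v *)
From mathcomp Require Import all_boot.
Set Implicit Arguments.
Unset Strict Implicit.
Unset Printing Implicit Defensive.

(* Sequences are indexed from 0 and spots are numbered from 1, so the
   condition b_i <= i (i >= 1) reads [nth 0 b i <= i.+1]. *)
Definition parking (s : seq nat) : bool :=
  all (leq 1) s && all (fun i => nth 0 (sort leq s) i <= i.+1) (iota 0 (size s)).

(* The entries of a parking function of length n are at most n, so nothing is
   lost by taking them in 'I_n.+1 = {0, ..., n} (see parking_le below);
   [parking] excludes the entry 0. *)
Definition prefs (n : nat) (pi : n.-tuple 'I_n.+1) : seq nat := map val pi.

Definition PF (n : nat) : {set n.-tuple 'I_n.+1} := [set pi | parking (prefs pi)].

Lemma parking_le (s : seq nat) : parking s -> all (fun a => a <= size s) s.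
Proof.
case/andP=> _ /allP sP; apply/allP=> a; rewrite -(mem_sort leq) => a_s.
have lt_i : index a (sort leq s) < size s by rewrite -(size_sort leq) index_mem.
have := sP (index a (sort leq s)); rewrite mem_iota /= add0n nth_index //.
by move=> /(_ lt_i) /leq_trans; apply.
Qed.

(* The first unoccupied spot among p, p+1, ..., n, or None if there is none. *)
Definition first_free (n : nat) (occ : seq nat) (p : nat) : option nat :=
  ohead [seq j <- iota p (n.+1 - p) | j \notin occ].

(* The spots taken by the cars with preferences s, in order of arrival, in a
   street with n spots where those in occ are occupied; None means that the car
   does not park. *)
Fixpoint park (n : nat) (occ s : seq nat) : seq (option nat) :=
  if s is p :: s' then
    let spot := first_free n occ p in
    spot :: park n (if spot is Some j then j :: occ else occ) s'
  else [::].

Definition outcome (s : seq nat) : seq (option nat) := park (size s) [::] s.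

Definition unl (s : seq nat) : nat :=
  count (fun c => c.2 != Some c.1) (zip s (outcome s)).

Definition lel (s : seq nat) : nat := count_mem (head 0 s) s.

Definition ones (s : seq nat) : nat := count_mem 1 s.

(* Main.v *)
Require Import Defs.
From HB Require Import structures.
From mathcomp Require Import all_boot all_order all_algebra.
From mathcomp Require Import zify ring.
Set Implicit Arguments.
Unset Strict Implicit.
Unset Printing Implicit Defensive.
Import Order.TTheory GRing.Theory Num.Theory.

(** Let the cars park one at a time, a lucky preference for spot j having weight
u j and an unlucky one z * u j, where u j collects the factors x and y.  The
total weight of the ways to complete a partially filled street depends only on
the weights a_1, ..., a_m, a_0 of the runs of occupied spots in front of each
free spot (and after the last one): the next car takes the i-th free spot with
total weight 1 + a_i, and then runs i and i+1 merge with weight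
a_i + a_(i+1) + z.  The first free spot is treated apart, since its preferences
may carry the factor y.  For individual runs this weight is complicated, but
averaged over all orders of the runs after the first free spot (the last one
included) it becomes a product of linear factors in their sum, by induction on
their number: merging two adjacent runs keeps the average exchangeable, and
exchangeability trades the weight of the run after the first free spot for that
of the last run.  When the first car prefers spot 1 all these runs are empty;
otherwise exactly one is not, and summing over the preference of the first car
is the average over its place. *)

(** * Parking functions as a condition preserved by the parking protocol *)

(* At least k cars want or occupy the first k spots, for all k; for s the
   concatenation of the occupied spots and the remaining preferences, this is
   invariant under parking a car. *)
Definition room (n : nat) (s : seq nat) : bool :=
  all (fun k => k <= count (leq^~ k) s) (iota 0 n.+1).

Lemma parking_room (s : seq nat) :
  parking s = all (leq 1) s && room (size s) s.
Proof.
rewrite /parking; congr (_ && _); apply/idP/idP => /allP h; apply/allP => k.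
  rewrite mem_iota add0n ltnS => /andP [_ kn].
  case: k kn => // i lt_in; have := h i; rewrite mem_iota add0n lt_in.
  move=> /(_ isT); apply: contraLR; rewrite -!ltnNge -(count_sort leq) => lt_i.
  apply: (@nth_count_gt _ nat i.+1 0); last by rewrite size_sort lt_in andbT.
  exact: sort_sorted leq_total _.
rewrite mem_iota add0n => /andP [_ lt_in]; have := h k.+1.
rewrite mem_iota /= add0n ltnS lt_in -(count_sort leq) => /(_ isT) lt_k.
by apply: (@nth_count_le _ nat k.+1) lt_k; apply: sort_sorted leq_total _.
Qed.

Lemma mem_first_free n occ p j : 0 < p -> first_free n occ p = Some j ->
  [/\ p <= j, j <= n, j \notin occ & forall q, p <= q < j -> q \in occ].
Proof.
rewrite /first_free => p_gt0.
move E: (n.+1 - p) => d; elim: d p p_gt0 E => [|d IHd] //= p p_gt0 hd.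
case: ifPn => [p_occ|/negPn p_occ] /=.
  by case=> <-; split=> //; lia.
case/(IHd p.+1 isT ltac:(lia)) => lt_pj le_jn j_occ free; split=> //; first exact: ltnW.
move=> q /andP [le_pq lt_qj]; case: (eqVneq q p) => [-> // | ne_qp].
by apply: free; rewrite lt_qj andbT ltn_neqAle eq_sym ne_qp.
Qed.

Lemma first_free_None n occ p : first_free n occ p = None ->
  forall q, p <= q <= n -> q \in occ.
Proof.
move=> h q pq; move: h; rewrite /first_free; case E: filter => [|//] _.
apply/negPn/negP => q_occ.
suff: q \in [seq j <- iota p (n.+1 - p) | j \notin occ] by rewrite E.
by rewrite mem_filter q_occ mem_iota; lia.
Qed.

Lemma first_free_id n occ p :
  p <= n -> (first_free n occ p == Some p) = (p \notin occ).
Proof.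
move=> le_pn; case p_occ: (p \in occ) => /=.
  apply/eqP => h; suff: p \in [seq j <- iota p (n.+1 - p) | j \notin occ].
    by rewrite mem_filter p_occ.
  by move: h; rewrite /first_free; case: filter => //= j s [->]; rewrite inE eqxx.
by rewrite /first_free subSn //= p_occ /= eqxx.
Qed.

Lemma count_leq_cover (occ : seq nat) a b : uniq occ -> a <= b ->
  (forall q, a < q <= b -> q \in occ) ->
  count (leq^~ a) occ + (b - a) <= count (leq^~ b) occ.
Proof.
move=> occ_uniq le_ab cover.
have -> : count (leq^~ b) occ
          = count (leq^~ a) occ + count (fun q => a < q <= b) occ.
  rewrite -count_predUI; set c := count (predI _ _) _.
  have -> : c = 0.
    by apply/eqP; rewrite -leqn0 leqNgt -has_count; apply/hasPn => q _ /=; lia.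
  by rewrite addn0; apply: eq_count => q /=; lia.
rewrite leq_add2l -[b - a](size_iota a.+1) -size_filter.
apply: uniq_leq_size (iota_uniq _ _) _ => q.
by rewrite mem_iota mem_filter => q_in; rewrite cover; lia.
Qed.

Lemma room_full n occ : uniq occ -> all (fun q => 0 < q <= n) occ ->
  size occ = n -> room n occ.
Proof.
move=> occ_uniq /allP occ_n sz; apply/allP => k.
rewrite mem_iota add0n ltnS => /andP [_ kn].
rewrite -(leq_add2r (n - k)) subnKC // -{1}sz -(count_predC (leq^~ k) occ).
rewrite leq_add2l -[n - k](size_iota k.+1) -size_filter.
apply: uniq_leq_size; first exact: filter_uniq.
by move=> q; rewrite mem_filter mem_iota /= => /andP [? /occ_n]; lia.
Qed.

(** The count drops only for [p <= k < j]; there the spots from [p] to [k] are occupied, so the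
    bound at [p.-1] gives the one at [k]. *)
Lemma room_first_free n occ p s j : uniq occ -> 0 < p ->
  first_free n occ p = Some j -> room n (occ ++ p :: s) = room n (j :: occ ++ s).
Proof.
move=> occ_uniq p_gt0 /(mem_first_free p_gt0) [le_pj le_jn _ cover].
apply/idP/idP => /allP h; apply/allP => k k_n; have := h k k_n.
  rewrite /= !count_cat /=; case: (leqP p k) => pk; last by rewrite leqNgt; lia.
  case: (leqP j k) => jk; first by lia.
  have := h p.-1; rewrite mem_iota count_cat /=.
  have := @count_leq_cover occ p.-1 k occ_uniq.
  have : count (leq^~ p.-1) s <= count (leq^~ k) s.
    by apply: sub_count => q /=; lia.
  move=> le_s le_occ hp _.
  have {}hp := hp ltac:(lia); have {}le_occ := le_occ ltac:(lia).
  have : count (leq^~ p.-1) occ + (k - p.-1) <= count (leq^~ k) occ.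
    by apply: le_occ => q hq; apply: cover; lia.
  by lia.
by rewrite /= !count_cat /=; lia.
Qed.

(** All spots from [p] to [n] are occupied; with the blocked car itself, this leaves fewer than
    [p.-1] cars for the first [p.-1] spots. *)
Lemma room_blocked n occ p s : uniq occ -> 0 < p <= n ->
  size occ + (size s).+1 = n -> first_free n occ p = None ->
  room n (occ ++ p :: s) = false.
Proof.
move=> occ_uniq /andP [p_gt0 le_pn] sz /first_free_None full; apply/negP => /allP h.
have := h p.-1; rewrite mem_iota count_cat /= => /(_ ltac:(lia)).
have := @count_leq_cover occ p.-1 n occ_uniq ltac:(lia).
move=> /(_ (fun q hq => full q ltac:(lia))).
have := count_size (leq^~ n) occ; have := count_size (leq^~ p.-1) s.
have -> : (p <= p.-1) = false by lia.
by move: (count _ s) (count _ occ) (count _ occ) (size occ) (size s) sz; lia.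
Qed.

(** * Exchangeable lists of runs and their merging *)

Local Open Scope ring_scope.

(** Adjacent transpositions generate all permutations, so invariance under them is exchangeability;
    out of range the list is unchanged. *)
Fixpoint swap_at (T : Type) (k : nat) (s : seq T) : seq T :=
  match k, s with
  | 0%N, a :: b :: t => b :: a :: t
  | k'.+1, a :: t => a :: swap_at k' t
  | _, _ => s
  end.

Lemma nth_swap_at (T : Type) x0 k (s : seq T) :
  (k.+1 < size s)%N -> nth x0 (swap_at k s) k = nth x0 s k.+1.
Proof. by elim: k s => [|k IHk] [|a [|b s]] //= h; apply: IHk. Qed.

Section Exchangeable.
Variable R : comNzRingType.
Implicit Types (P : Type) (s : seq R) (a b c : R).

Lemma sum_swap_at k s : \sum_(a <- swap_at k s) a = \sum_(a <- s) a.
Proof.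
elim: k s => [|k IHk] [|a [|b s]] //=; first by rewrite !big_cons addrCA.
  by case: k {IHk}.
by rewrite !(big_cons _ _ a) IHk.
Qed.

(* L stands for a weighted sum over pairs (p, s) in which the law of the list s,
   of size n, is exchangeable given p. *)
Record exchangeable P (n : nat) (L : (P -> seq R -> R) -> R) : Prop :=
  Exchangeable {
    exch_ext : forall F G,
      (forall p s, size s = n -> F p s = G p s) -> L F = L G;
    exch_add : forall F G, L (fun p s => F p s + G p s) = L F + L G;
    exch_swap : forall k F, L (fun p s => F p (swap_at k s)) = L F }.

Lemma exch_scale P n L (f : P -> R) :
  exchangeable n L -> exchangeable n (fun F => L (fun p s => f p * F p s)).
Proof.
case=> Le La Ls; split=> [F G FG | F G | k F].
- by apply: Le => p s hs; rewrite FG.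
- by rewrite -La; apply: Le => p s _; rewrite mulrDr.
- exact: (Ls k (fun p s => f p * F p s)).
Qed.

(** This is conditioning on the head: a swap at [k] in the rest is a swap at [k.+1] in the whole
    list. *)
Lemma exch_behead P n L : @exchangeable P n.+1 L ->
  @exchangeable (P * R) n (fun F => L (fun p s => F (p, head 0 s) (behead s))).
Proof.
case=> Le La Ls; split=> [F G FG | F G | k F].
- by apply: Le => p s hs; rewrite FG // size_behead hs.
- by rewrite -La; apply: Le.
- rewrite -(Ls k.+1 (fun p s => F (p, head 0 s) (behead s))).
  by apply: Le => p [|a s].
Qed.

(** A swap keeps the sum and brings entry [i.+1] to place [i], so all places are equivalent against
    a function of the sum. *)
Lemma exch_head_last P n L (h : P -> R -> R) : @exchangeable P n.+1 L ->
  L (fun p s => head 0 s * h p (\sum_(a <- s) a))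
  = L (fun p s => last 0 s * h p (\sum_(a <- s) a)).
Proof.
case=> Le La Ls.
suff nthP i : (i <= n)%N -> L (fun p s => s`_i * h p (\sum_(a <- s) a))
                        = L (fun p s => s`_0 * h p (\sum_(a <- s) a)).
  transitivity (L (fun p s => s`_n * h p (\sum_(a <- s) a))).
    by rewrite nthP //; apply: Le => p s _; rewrite nth0.
  by apply: Le => p s hs; rewrite -nth_last hs.
elim: i => [//|i IHi] lt_in; rewrite -(IHi (ltnW lt_in)).
rewrite -(Ls i (fun p s => s`_i * h p (\sum_(a <- s) a))).
by apply: Le => p s hs; rewrite sum_swap_at nth_swap_at // hs ltnS.
Qed.

Variable z : R.

(* The list holds the weights of the runs between free spots; a car with a
   preference in the run a, or for the free spot behind it, parks in that spot. *)
Fixpoint merge_sum (F : seq R -> R) s : R :=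
  if s is a :: s' then
    (if s' is b :: t then (1 + a) * F ((a + b + z) :: t) else 0)
    + merge_sum (fun t => F (a :: t)) s'
  else 0.

Lemma merge_sum_cons2 F a b s :
  merge_sum F (a :: b :: s)
  = (1 + a) * F ((a + b + z) :: s) + merge_sum (fun t => F (a :: t)) (b :: s).
Proof. by []. Qed.

Lemma eq_merge_sum n F G s : size s = n.+1 ->
  (forall t, size t = n -> F t = G t) -> merge_sum F s = merge_sum G s.
Proof.
elim: n F G s => [|n IHn] F G [|a [|b s]] // [ss] FG.
rewrite !merge_sum_cons2 FG; last by rewrite /= ss.
rewrite (IHn _ (fun t => G (a :: t)) (b :: s)) //; first by rewrite /= ss.
by move=> t st; apply: FG; rewrite /= st.
Qed.

Lemma merge_sumD F G s :
  merge_sum (fun t => F t + G t) s = merge_sum F s + merge_sum G s.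
Proof.
elim: s F G => [|a s IHs] F G /=; first by rewrite addr0.
by rewrite IHs; case: s {IHs} => [|b s]; ring.
Qed.

(** Every merge raises the total by the same [z], and the weights [1 + a] run over all entries but
    the last, which has no free spot behind it. *)
Lemma merge_sum_sum (h : R -> R) s :
  merge_sum (fun t => h (\sum_(a <- t) a)) s
  = ((size s).-1%:R + \sum_(a <- s) a - last 0 s) * h (\sum_(a <- s) a + z).
Proof.
case: s => [|a s]; first by rewrite /= big_nil addr0 subr0 mul0r.
elim: s a h => [|b s IHs] a h.
  by rewrite /= big_cons big_nil; ring.
rewrite merge_sum_cons2.
rewrite (@eq_merge_sum (size s) _ (fun t => h (a + \sum_(c <- t) c))) //;
  last by move=> t _; rewrite big_cons.
rewrite (IHs b (fun x => h (a + x))) /= !big_cons -!addrA.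
have -> : a + (b + (z + \sum_(j <- s) j)) = a + (b + (\sum_(j <- s) j + z)).
  by ring.
by rewrite -[(size s).+1]addn1 natrD; ring.
Qed.

(** Exchangeability survives a merge. In the induction on [k] the head joins the parameter for the
    merges that leave it alone, hence the generalization over [P]. *)
Lemma exch_merge_swap P n L k (F : P -> seq R -> R) : @exchangeable P n.+1 L ->
  L (fun p s => merge_sum (fun t => F p (swap_at k t)) s)
  = L (fun p s => merge_sum (F p) s).
Proof.
elim: k n P L F => [|k IHk] n P L F exL; have [Le La Ls] := exL.
  case: n => [|[|n]] in L exL Le La Ls *.
  - by apply: Le => p [|a [|b s]].
  - by apply: Le => p [|a [|b [|c s]]].
  (* Swapping the first two runs after a merge turns the merge of the first two
     of three runs into a merge of the last two, up to a rotation, and back. *)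
  pose A p s := if s is a :: b :: c :: t then
                  (1 + a) * F p (c :: (a + b + z) :: t) else 0.
  pose B p s := if s is a :: b :: c :: t then
                  (1 + b) * F p ((b + c + z) :: a :: t) else 0.
  pose C p s := if s is a :: b :: t then
                  merge_sum (fun u => F p (b :: a :: u)) t else 0.
  pose A' p s := if s is a :: b :: c :: t then
                  (1 + a) * F p ((a + b + z) :: c :: t) else 0.
  pose B' p s := if s is a :: b :: c :: t then
                  (1 + b) * F p (a :: (b + c + z) :: t) else 0.
  pose C' p s := if s is a :: b :: t then
                  merge_sum (fun u => F p (a :: b :: u)) t else 0.
  transitivity (L (fun p s => A p s + (B p s + C p s))).
    by apply: Le => p [|a [|b [|c s]]].
  transitivity (L (fun p s => A' p s + (B' p s + C' p s))); last first.
    by apply: Le => p [|a [|b [|c s]]].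
  have -> : L (fun p s => A p s + (B p s + C p s)) = L A + L B + L C.
    by rewrite -addrA -La -La.
  have -> : L (fun p s => A' p s + (B' p s + C' p s)) = L B' + L A' + L C'.
    by rewrite [L B' + _]addrC -addrA -La -La.
  congr (_ + _ + _).
  - rewrite -(Ls 0%N B') -(Ls 1%N (fun p s => B' p (swap_at 0 s))).
    by apply: Le => p [|a [|b [|c s]]].
  - rewrite -(Ls 1%N A') -(Ls 0%N (fun p s => A' p (swap_at 1 s))).
    by apply: Le => p [|a [|b [|c s]]].
  - by rewrite -(Ls 0%N C'); apply: Le => p [|a [|b s]].
case: n => [|n] in L exL Le La Ls *; first by apply: Le => p [|a [|b s]].
pose F' (q : P * R) t := F q.1 (q.2 :: t).
pose T G := L (fun p s => merge_sum (G (p, head 0 s)) (behead s)).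
have split_merge G :
    L (fun p s => merge_sum (G p) s)
    = L (fun p s => if s is a :: b :: t then (1 + a) * G p (a + b + z :: t) else 0)
      + T (fun q t => G q.1 (q.2 :: t)).
  by rewrite -La; apply: Le => p [|a [|b s]].
rewrite (split_merge F) (split_merge (fun p t => F p (swap_at k.+1 t))).
congr (_ + _); last exact: (IHk _ _ _ F' (exch_behead exL)).
(* Merging the first two runs shifts later places down by one: a swap at [k.+1] after it is a swap
   at [k.+2] before it. *)
by rewrite -[RHS](Ls k.+2); apply: Le => p [|a [|b s]].
Qed.

Lemma exch_merge P n L : @exchangeable P n.+1 L ->
  exchangeable n (fun F => L (fun p s => merge_sum (F p) s)).
Proof.
move=> exL; have [Le La Ls] := exL; split=> [F G FG | F G | k F].
- by apply: Le => p s hs; apply: eq_merge_sum hs _; apply: FG.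
- by rewrite -La; apply: Le => p s _; rewrite merge_sumD.
- exact: (exch_merge_swap k F exL).
Qed.

(* Here c is the weight of the run containing the spot that was the first free
   one, once that spot has been taken. *)
Fixpoint fill_weight (m : nat) c s : R :=
  if m is m'.+1 then
    (1 + c + head 0 s) * fill_weight m' (c + head 0 s + z) (behead s)
    + merge_sum (fill_weight m' c) s
  else 1.

(** Starting from [m.+1] free spots and total run weight [t], factor [i] is the number of free spots
    plus the total weight after [i] merges. *)
Definition fill_prod (m : nat) (t : R) : R :=
  \prod_(0 <= i < m) (t + m.+1%:R - i%:R * (1 - z)).

Lemma fill_prodS m t :
  fill_prod m.+1 t = (t + m.+2%:R) * fill_prod m (t + z).
Proof.
rewrite /fill_prod big_nat_recl //; congr (_ * _); first by ring.
by apply: eq_big_nat => i _; rewrite -(addn1 m.+1) -(addn1 i) !natrD; ring.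
Qed.

(** In the step to [m.+1], the induction hypothesis turns both terms into [fill_prod] at the total
    plus [z], with coefficients [1 + c + head] and [m.+1 + sum - last]. Trading head for last leaves
    [c + sum + m.+2]. *)
Lemma exch_fill_weight P m L (c : P -> R) : @exchangeable P m.+1 L ->
  L (fun p s => fill_weight m (c p) s)
  = L (fun p s => fill_prod m (c p + \sum_(a <- s) a)).
Proof.
elim: m P L c => [|m IHm] P L c exL; have [Le La Ls] := exL.
  by apply: Le => p s _; rewrite /fill_prod big_geq.
have exL1 := exch_scale (fun q => 1 + c q.1 + q.2) (exch_behead exL).
have exL2 := exch_merge exL.
rewrite (La (fun p s => (1 + c p + head 0 s)
               * fill_weight m (c p + head 0 s + z) (behead s))).
rewrite [X in X + _](IHm _ _ (fun q => c q.1 + q.2 + z) exL1).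
rewrite [X in _ + X](IHm _ _ c exL2) -La.
pose h p t := fill_prod m (c p + t + z).
pose A p s := (c p + \sum_(a <- s) a + m.+2%:R - last 0 s)
              * h p (\sum_(a <- s) a).
transitivity (L (fun p s => A p s + head 0 s * h p (\sum_(a <- s) a))).
  apply: Le => p s hs; rewrite (merge_sum_sum (fun t => fill_prod m (c p + t))) hs /A /h.
  case: s hs => [//|a s] _ /=; rewrite !big_cons.
  set S := \sum_(j <- s) j; rewrite -(addn1 m.+1) natrD.
  have -> : c p + a + z + S = c p + (a + S) + z by ring.
  have -> : c p + (a + S + z) = c p + (a + S) + z by ring.
  by ring.
rewrite La (exch_head_last h exL) -La; apply: Le => p s _.
by rewrite fill_prodS /A /h; ring.
Qed.

End Exchangeable.

(** * The weight of filling a street, in terms of its runs *)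

Lemma sum_cons_tuple (V : nmodType) (T : finType) k (F : k.+1.-tuple T -> V) :
  \sum_t F t = \sum_p \sum_t F (cons_tuple p t).
Proof.
rewrite pair_bigA (reindex (fun pt : T * k.-tuple T => cons_tuple pt.1 pt.2)) //.
exists (fun t : k.+1.-tuple T => (thead t, behead_tuple t)).
  by move=> [p t] _ /=; congr (_, _); apply: val_inj.
by move=> t _; apply: val_inj; rewrite /= [in RHS](tuple_eta t).
Qed.

Lemma sum_iota1 (V : nmodType) (F : nat -> V) n :
  \sum_(p <- iota 1 n) F p = \sum_(p < n) F p.+1.
Proof.
have -> : iota 1 n = index_iota 1 n.+1 by rewrite /index_iota subn1.
by rewrite big_add1 big_mkord.
Qed.

Lemma count_notin_cons (T : eqType) (occ : seq T) j l :
  uniq l -> j \in l -> j \notin occ ->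
  count (fun i => i \notin occ) l = (count (fun i => i \notin j :: occ) l).+1.
Proof.
move=> l_uniq jl j_occ; have one_j : count_mem j l = 1%N by rewrite count_uniq_mem ?jl.
rewrite -add1n -{1}one_j {l_uniq jl one_j}.
elim: l => //= i l ->; rewrite inE negb_or.
by case: eqVneq => [->|_] /=; rewrite ?j_occ; lia.
Qed.

Section Street.
Variables (R : comNzRingType) (z : R) (n : nat) (u : nat -> R).
Implicit Types (occ s l : seq nat) (a b : R).

Definition pref_weight occ p : R := if p \in occ then z * u p else u p.

Fixpoint walk occ s : R :=
  if s is p :: s' then
    if first_free n occ p is Some j then pref_weight occ p * walk (j :: occ) s'
    else 0
  else 1.

(** Along the protocol, [room] is kept by each parked car, fails when a car is blocked, and holds
    for the full street. *)
Lemma walkE occ s : uniq occ -> all (fun q => 0 < q <= n)%N occ ->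
  all (fun q => 0 < q <= n)%N s -> (size occ + size s)%N = n ->
  walk occ s = if room n (occ ++ s) then
      (\prod_(p <- s) u p)
      * z ^+ count (fun c => c.2 != Some c.1) (zip s (park n occ s))
    else 0.
Proof.
elim: s occ => [|p s IHs] occ occ_uniq occ_n /= => [_|/andP [p_n s_n]] sz.
  by rewrite cats0 room_full ?big_nil ?mulr1 // -sz addn0.
have [p_gt0 le_pn] := andP p_n.
case E: first_free => [j|]; last by rewrite room_blocked.
rewrite -E first_free_id // (room_first_free s occ_uniq p_gt0 E).
have [le_pj le_jn j_occ _] := mem_first_free p_gt0 E.
rewrite IHs //=; first last.
- by rewrite addSnnS.
- by rewrite occ_n andbT; lia.
- by rewrite j_occ.
rewrite -cat_cons; case: ifP => _; last by rewrite mulr0.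
by rewrite big_cons /pref_weight; case: (p \in occ) => /=; rewrite ?exprS; ring.
Qed.

Fixpoint park_sum k occ : R :=
  if k is k'.+1 then
    \sum_(p <- iota 1 n)
      if first_free n occ p is Some j then
        pref_weight occ p * park_sum k' (j :: occ)
      else 0
  else 1.

(* The next car grouped by the spot j where it parks; a is the weight of the
   occupied spots passed since the last free one. *)
Fixpoint spot_sum (H : nat -> R) occ a l : R :=
  if l is j :: l' then
    if j \in occ then spot_sum H occ (a + z * u j) l'
    else (a + u j) * H j + spot_sum H occ 0 l'
  else 0.

(** The weight [a] of preferences for spots before [b] is carried to the first free spot from [b]
    on, if there is one. *)
Lemma sum_first_free (H : nat -> R) occ a (b d : nat) : (b + d = n.+1)%N ->
  a * oapp H 0 (first_free n occ b)
  + \sum_(p <- iota b d)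
      (if first_free n occ p is Some j then pref_weight occ p * H j else 0)
  = spot_sum H occ a (iota b d).
Proof.
elim: d a b => [|d IHd] a b bd /=.
  rewrite big_nil /first_free; have -> : (n.+1 - b = 0)%N by lia.
  by rewrite /= mulr0 addr0.
rewrite big_cons /pref_weight; case: ifPn => b_occ.
  rewrite -IHd; last by lia.
  have -> : first_free n occ b = first_free n occ b.+1.
    by rewrite /first_free subSn /=; [rewrite b_occ subSS | lia].
  by rewrite addrA mulrDl; case: first_free => /= [j|]; rewrite ?mulr0 //.
have /eqP -> : first_free n occ b == Some b by rewrite first_free_id //; lia.
by rewrite -IHd /=; [ring | lia].
Qed.

(* Weights of the maximal runs of occupied spots, possibly empty, delimited by
   the free spots of l; a is added to the first one. *)
Fixpoint blocks occ a l : seq R :=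
  if l is j :: l' then
    if j \in occ then blocks occ (a + z * u j) l' else a :: blocks occ 0 l'
  else [:: a].

Lemma blocksD occ a b l :
  blocks occ (a + b) l
  = (a + head 0 (blocks occ b l)) :: behead (blocks occ b l).
Proof. by elim: l b => [|j l IHl] b //=; case: ifP; rewrite // -addrA IHl. Qed.

Lemma blocks_notin occ a j l :
  j \notin l -> blocks (j :: occ) a l = blocks occ a l.
Proof.
elim: l a => [|i l IHl] a //=; rewrite !inE negb_or eq_sym => /andP [/negPf -> jl].
by rewrite /= !IHl.
Qed.

Lemma size_blocks occ a l : size (blocks occ a l) = (count (fun j => j \notin occ) l).+1.
Proof. by elim: l a => [|j l IHl] a //=; case: ifP => _ /=; rewrite ?IHl. Qed.

Lemma eq_spot_sum H H' occ a l :
  (forall j, j \in l -> j \notin occ -> H j = H' j) ->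
  spot_sum H occ a l = spot_sum H' occ a l.
Proof.
elim: l a => [|j l IHl] a //= HH'.
have HH'l i : i \in l -> i \notin occ -> H i = H' i.
  by move=> il; apply: HH'; rewrite inE il orbT.
by case: ifPn => j_occ; rewrite (IHl _ HH'l) // HH' // mem_head.
Qed.

(** Taking the free spot [j] joins the runs on both sides of it, and [j] itself adds
    [z * u j = z]. *)
Lemma spot_sum_blocks (F : seq R -> R) occ a l : uniq l ->
  (forall j, j \in l -> j \notin occ -> u j = 1) ->
  spot_sum (fun j => F (blocks (j :: occ) a l)) occ a l
  = merge_sum z F (blocks occ a l).
Proof.
elim: l F a => [|j l IHl] F a /=; first by rewrite addr0.
case/andP=> jl l_uniq u1.
have u1l i : i \in l -> i \notin occ -> u i = 1.
  by move=> il; apply: u1; rewrite inE il orbT.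
case: ifPn => j_occ.
  rewrite -IHl //; apply: eq_spot_sum => i _ _.
  by rewrite inE j_occ orbT.
rewrite mem_head u1 ?mem_head // mulr1 blocks_notin //.
rewrite (@eq_spot_sum _ (fun i => F (a :: blocks (i :: occ) 0 l))); last first.
  move=> i il _; rewrite inE (negPf j_occ) orbF.
  by case: eqP jl => // ->; rewrite il.
rewrite (IHl (fun t => F (a :: t)) 0 l_uniq u1l).
rewrite -[a + z]addr0 blocksD [a + 1]addrC.
have := size_blocks occ 0 l; case: (blocks occ 0 l) => [|b t] //= _.
by rewrite addrAC.
Qed.

Definition tail_weight a (s : seq R) : R := fill_weight z (size s).-1 a s.

(** The run before the first free spot [j] stays as it is until [j] is taken, so the car taking [j]
    contributes [a + u j] whenever it comes. That factor is pulled out. *)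
Fixpoint street_weight occ a l : R :=
  if l is j :: l' then
    if j \in occ then street_weight occ (a + z * u j) l'
    else (a + u j) * tail_weight (a + z * u j) (blocks occ 0 l')
  else 1.

Lemma street_weight_free occ a j l : j \notin occ ->
  street_weight occ a (j :: l)
  = (a + u j) * tail_weight (a + z * u j) (blocks occ 0 l).
Proof. by move=> /= /negPf ->. Qed.

Lemma street_weight_blocks occ a l :
  (forall j, j \in l -> j \notin occ -> u j = 1) ->
  street_weight occ a l =
    let b := head 0 (blocks occ a l) in let s := behead (blocks occ a l) in
    if s is [::] then 1 else (1 + b) * tail_weight (b + z) s.
Proof.
elim: l a => [|j l IHl] a //= u1.
have u1l i : i \in l -> i \notin occ -> u i = 1.
  by move=> il; apply: u1; rewrite inE il orbT.
case: ifPn => j_occ; first exact: IHl.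
rewrite u1 ?mem_head //= mulr1 [1 + a]addrC.
by have := size_blocks occ 0 l; case: (blocks occ 0 l).
Qed.

Lemma merge_sumZ (F : seq R -> R) a (s : seq R) :
  merge_sum z (fun t => a * F t) s = a * merge_sum z F s.
Proof.
elim: s F => [|b s IHs] F /=; first by rewrite mulr0.
by rewrite IHs; case: s {IHs} => [|c s]; ring.
Qed.

Local Arguments merge_sum : simpl never.

(** This is the recursion of [park_sum]. Whether the next car takes the first free spot or a later
    one, the factor [a + u j] comes out, leaving the two terms of [fill_weight]. The first spot of
    [l] is exempt from [u j = 1], as spot 1 may carry [y]. *)
Lemma spot_sum_street_weight occ a l : uniq l ->
  (forall j, j \in behead l -> j \notin occ -> u j = 1) ->
  has (fun j => j \notin occ) l ->
  spot_sum (fun j => street_weight (j :: occ) a l) occ a l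
  = street_weight occ a l.
Proof.
elim: l a => [|j l IHl] a //= /andP [jl l_uniq] u1.
case: ifPn => j_occ /= l_free.
  rewrite -IHl //; first by apply: eq_spot_sum => i _ _; rewrite inE j_occ orbT.
  by move=> i il; apply: u1; apply: mem_behead.
rewrite mem_head.
set c := a + z * u j; set al := a + u j.
rewrite (@eq_spot_sum _ (fun i => al * tail_weight c (blocks (i :: occ) 0 l)));
  last first.
  move=> i il _; rewrite inE (negPf j_occ) orbF.
  by case: eqP jl => // ->; rewrite il.
rewrite (spot_sum_blocks (fun t => al * tail_weight c t)) // merge_sumZ -mulrDr.
congr (_ * _); rewrite street_weight_blocks; last first.
  by move=> i il; rewrite inE negb_or => /andP [_]; apply: u1.
rewrite blocks_notin // -[c]addr0 blocksD addr0 /=.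
have := size_blocks occ 0 l; case: (blocks occ 0 l) => [|b [|b' s]] //= _.
  by rewrite /merge_sum !addr0.
rewrite /tail_weight /= [1 + (c + b)]addrA; congr (_ + _).
by apply: (@eq_merge_sum _ _ (size s).+1) => // t ->.
Qed.

Lemma park_sumE k occ :
  (forall j, (1 < j <= n)%N -> j \notin occ -> u j = 1) ->
  count (fun j => j \notin occ) (iota 1 n) = k ->
  park_sum k occ = street_weight occ 0 (iota 1 n).
Proof.
elim: k occ => [|k IHk] occ u1 free_k.
  suff: forall a l, count (fun j => j \notin occ) l = 0%N ->
      street_weight occ a l = 1 by move=> ->.
  by move=> a l; elim: l a => [|j l IHl] a //=; case: (j \in occ) => //= /IHl.
have n_gt0 : (0 < n)%N by case: (n) free_k.
have u1' j : j \in behead (iota 1 n) -> j \notin occ -> u j = 1.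
  by move=> jn; apply: u1; move: jn n_gt0; case: (n) => //= m; rewrite mem_iota; lia.
rewrite -spot_sum_street_weight ?iota_uniq ?has_count ?free_k //=.
rewrite -(sum_first_free _ _ _ (add1n n)) mul0r add0r.
apply: eq_big_seq => p; rewrite mem_iota => p_n.
case E: first_free => [j|] //; congr (_ * _).
have [|le_pj le_jn j_occ _] := mem_first_free _ E; first by lia.
apply: IHk => [i i_n|]; first by rewrite inE negb_or => /andP [_]; apply: u1.
apply: succn_inj; rewrite -free_k (@count_notin_cons _ occ j) ?iota_uniq //.
by rewrite mem_iota; lia.
Qed.

Lemma sum_walk k occ :
  \sum_(t : k.-tuple 'I_n.+1) (if all (leq 1) (map val t)
     then walk occ (map val t) else 0) = park_sum k occ.
Proof.
elim: k occ => [|k IHk] occ.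
  by rewrite (big_pred1 [tuple]) // => t; rewrite [t]tuple0 /= eqxx.
rewrite sum_cons_tuple /=.
(* The preference 0 contributes nothing because of the test [all (leq 1)]. *)
rewrite sum_iota1 big_ord_recl /= big1 // add0r; apply: eq_bigr => p _; rewrite /bump /= add1n.
case: first_free => [j|].
  by rewrite -IHk mulr_sumr; apply: eq_bigr => t _; case: ifP; rewrite ?mulr0.
by apply: big1 => t _; case: ifP.
Qed.
End Street.

(** * A single nonempty run, summed over its places *)

Section Place.
Variables (R : comNzRingType) (z : R).

(** This is [m] times the average over the place of [v]; a sum avoids division in [R]. *)
Fixpoint place (v : R) (m : nat) (F : seq R -> R) : R :=
  if m is m'.+1 then F (v :: nseq m' 0) + place v m' (fun t => F (0 :: t))
  else 0.

Lemma eq_place v m F G :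
  (forall s, size s = m -> F s = G s) -> place v m F = place v m G.
Proof.
elim: m F G => [//|m IHm] F G FG /=; rewrite FG /= ?size_nseq //; congr (_ + _).
by apply: IHm => s hs; apply: FG; rewrite /= hs.
Qed.

Lemma placeD v m F G :
  place v m (fun s => F s + G s) = place v m F + place v m G.
Proof. by elim: m F G => [|m IHm] F G /=; rewrite ?IHm; ring. Qed.

Lemma swap_at_nseq (T : Type) k m (a : T) : swap_at k (nseq m a) = nseq m a.
Proof. by elim: k m => [|k IHk] [|m] //=; [case: m | rewrite IHk]. Qed.

Lemma place_swap v m k F : place v m (fun s => F (swap_at k s)) = place v m F.
Proof.
elim: m k F => [//|m IHm] [|k] F /=.
  by case: m {IHm} => [//|m] /=; rewrite addrCA.
by rewrite swap_at_nseq (IHm k (fun t => F (0 :: t))).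
Qed.

Lemma place_sum v m (h : R -> R) :
  place v m (fun s => h (\sum_(a <- s) a)) = m%:R * h v.
Proof.
elim: m => [|m IHm] /=; first by rewrite mul0r.
rewrite big_cons big_nseq (_ : iter _ _ _ = 0) ?addr0; last first.
  by elim: m {IHm} => //= m ->; rewrite addr0.
rewrite (@eq_place _ _ _ (fun s => h (\sum_(a <- s) a))) ?IHm.
  by rewrite -add1n natrD mulrDl mul1r.
by move=> s _; rewrite big_cons add0r.
Qed.

Lemma exch_place v m : exchangeable (P := unit) m (fun F => place v m (F tt)).
Proof.
split=> [F G FG | F G | k F]; [exact/eq_place/FG | exact: placeD|].
exact: place_swap.
Qed.

Lemma exch_nseq m : exchangeable (P := unit) m (fun F => F tt (nseq m (0 : R))).
Proof.
split=> [F G FG | F G | k F] //; first by apply: FG; rewrite size_nseq.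
by rewrite swap_at_nseq.
Qed.

Lemma fill_weight_nseq m c : fill_weight z m c (nseq m.+1 0) = fill_prod z m c.
Proof.
rewrite (exch_fill_weight z (fun=> c) (exch_nseq m.+1)) big_nseq.
by congr (fill_prod _ _ _); elim: m.+1 => /= [|k]; rewrite ?add0r ?addr0.
Qed.

Lemma fill_weight_place v m c :
  place v m.+1 (fill_weight z m c) = m.+1%:R * fill_prod z m (c + v).
Proof.
rewrite (exch_fill_weight z (fun=> c) (exch_place v m.+1)).
exact: (place_sum v m.+1 (fun t => fill_prod z m (c + t))).
Qed.

Lemma blocks_free (u : nat -> R) occ a l :
  (forall j, j \in l -> j \notin occ) ->
  blocks z u occ a l = a :: nseq (size l) 0.
Proof.
elim: l a => [|j l IHl] a //= l_occ; rewrite (negPf (l_occ j (mem_head _ _))).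
by rewrite IHl // => i il; apply: l_occ; rewrite inE il orbT.
Qed.

Lemma sum_blocks (u : nat -> nat -> R) v (F : seq R -> R) b d :
  (forall p, (b <= p)%N -> z * u p p = v) ->
  \sum_(p <- iota b d) F (blocks z (u p) [:: p] 0 (iota b d))
  = place v d F.
Proof.
elim: d b F => [|d IHd] b F uv /=; first by rewrite big_nil.
rewrite big_cons inE eqxx add0r uv // blocks_free ?size_iota => [|j]; last first.
  by rewrite mem_iota inE; lia.
rewrite -(IHd b.+1 (fun t => F (0 :: t))) => [|p lt_bp]; last first.
  by apply: uv; apply: ltnW.
congr (_ + _); apply: eq_big_seq => p; rewrite mem_iota inE => p_in.
by case: eqP p_in => // ->; lia.
Qed.

End Place.

(** * Summation over the preference of the first car *)

Local Arguments park_sum : simpl never.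

Theorem theorem4p2 (R : comNzRingType) (x y z : R) (n : nat) (hn : (2 <= n)%N) :
  \sum_(pi in PF n)
     x ^+ lel (prefs pi) * y ^+ ones (prefs pi) * z ^+ unl (prefs pi)
  = x * y *
    ((n%:R - 1) *
       \prod_(1 <= i < n.-1) (x * z + y * z + (i%:R - 1) * z + n%:R - i%:R)
     + (x * y * z + 1) *
       \prod_(1 <= i < n.-1) (x * y * z + i%:R * z + n%:R - i%:R)).
Proof.
(* Here [p] is the preference of the first car, so that [x] marks the preferences equal to it. *)
pose u p q : R := x ^+ (q == p) * y ^+ (q == 1%N).
have prod_u p s : \prod_(q <- s) u p q = x ^+ count_mem p s * y ^+ count_mem 1%N s.
  elim: s => [|q s IHs]; first by rewrite big_nil mulr1.
  by rewrite big_cons IHs /u /= !exprD; ring.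
case: n hn => [//|[//|m]] _.
transitivity (\sum_(t : m.+2.-tuple 'I_m.+3) if all (leq 1) (map val t)
                then walk z m.+2 (u (head 0%N (map val t))) [::] (map val t) else 0).
  rewrite big_mkcond; apply: eq_bigr => t _; rewrite inE /prefs.
  set s := map val t; have sz : size s = m.+2 by rewrite size_map size_tuple.
  rewrite parking_room sz; case: ifP => [/andP [s_pos s_room]|].
    rewrite s_pos walkE //; last first.
      apply/allP => q q_s; move/allP/(_ q q_s): s_pos => /= ->.
      by case/mapP: q_s => i _ ->; rewrite -ltnS ltn_ord.
    by rewrite s_room prod_u /unl /outcome sz.
  case: (boolP (all (leq 1) s)) => //= s_pos s_room; rewrite walkE //.
    by rewrite s_room.
  apply/allP => q q_s; move/allP/(_ q q_s): s_pos => /= ->.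
  by case/mapP: q_s => i _ ->; rewrite -ltnS ltn_ord.
(* The first car finds an empty street and parks at its preference [p], without a factor [z]. *)
transitivity (\sum_(p <- iota 1 m.+2) u p p * park_sum z m.+2 (u p) m.+1 [:: p]).
  rewrite sum_iota1 sum_cons_tuple big_ord_recl /= big1 // add0r.
  apply: eq_bigr => p _; rewrite /bump /= add1n -sum_walk mulr_sumr.
  apply: eq_bigr => t _; have -> : first_free m.+2 [::] p.+1 = Some p.+1.
    by apply/eqP; rewrite first_free_id.
  by rewrite /pref_weight in_nil; case: ifP; rewrite ?mulr0.
have u1 p j : j != p -> j != 1%N -> u p j = 1.
  by move=> /negPf jp /negPf j1; rewrite /u jp j1 mulr1.
have park_sum_p p : (1 <= p <= m.+2)%N ->
    park_sum z m.+2 (u p) m.+1 [:: p] = street_weight z (u p) [:: p] 0 (iota 1 m.+2).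
  move=> p_n; apply: park_sumE => [j j_n|].
    by rewrite inE => jp; apply: u1 => //; lia.
  apply: succn_inj; rewrite -(@count_notin_cons _ [::]) ?iota_uniq //.
    by rewrite (eq_count (a2 := predT)) ?count_predT ?size_iota.
  by rewrite mem_iota; lia.
rewrite (eq_big_seq (fun p => u p p
          * street_weight z (u p) [:: p] 0 (iota 1 m.+2))); last first.
  by move=> p; rewrite mem_iota => p_n; rewrite park_sum_p //; lia.
(* Spot 2 is the first free one, behind a run of weight [x * y * z]; the [m.+1] runs after it are
   empty. *)
have lucky_first : street_weight z (u 1%N) [:: 1%N] 0 (iota 1 m.+2)
                   = (x * y * z + 1) * fill_prod z m (x * y * z + z).
  rewrite /= (u1 1%N 2%N) // blocks_free ?size_iota => [|j]; last first.
    by rewrite mem_iota inE; lia.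
  rewrite -[0 :: _]/(nseq m.+1 0) /tail_weight size_nseq fill_weight_nseq add0r mulr1.
  by rewrite [z * _]mulrC.
(* Spot 1 is the first free one, with nothing in front: it gives [y], and the first car gives
   [x]. *)
have other_first p : (1 < p <= m.+2)%N ->
    u p p * street_weight z (u p) [:: p] 0 (iota 1 m.+2)
    = x * y * fill_weight z m (y * z) (blocks z (u p) [:: p] 0 (iota 2 m.+1)).
  move=> p_n; rewrite -[iota 1 m.+2]/(1%N :: iota 2 m.+1).
  have p_neq1 : (p == 1%N) = false by lia.
  have neq1_p : (1%N == p) = false by lia.
  rewrite street_weight_free ?inE ?neq1_p // /tail_weight size_blocks.
  have -> : count (fun j => j \notin [:: p]) (iota 2 m.+1) = m.
    apply: succn_inj; rewrite -(@count_notin_cons _ [::]) ?iota_uniq //.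
      by rewrite (eq_count (a2 := predT)) ?count_predT ?size_iota.
    by rewrite mem_iota; lia.
  by rewrite /u eqxx p_neq1 neq1_p /= !expr1 expr0 mulr1 mul1r !add0r mulrA [z * y]mulrC.
have u_first : u 1%N 1%N = x * y by [].
have split_first (F : nat -> R) :
    \sum_(p <- iota 1 m.+2) F p = F 1%N + \sum_(p <- iota 2 m.+1) F p.
  by rewrite -[iota 1 m.+2]/(1%N :: iota 2 m.+1) big_cons.
rewrite split_first u_first lucky_first.
rewrite (eq_big_seq (fun p => x * y
    * fill_weight z m (y * z) (blocks z (u p) [:: p] 0 (iota 2 m.+1)))); last first.
  by move=> p; rewrite mem_iota => p_in; apply: other_first; lia.
rewrite -mulr_sumr (@sum_blocks _ _ u (x * z)) => [|p p_gt1]; last first.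
  by rewrite /u eqxx (_ : (p == 1%N) = false) ?mulr1 ?expr1 1?mulrC //; lia.
(* The [m.+1] places of the run of weight [x * z] yield the coefficient [n - 1]. *)
rewrite fill_weight_place -mulrDr addrC; congr (_ * _).
rewrite /fill_prod !big_add1 -[m.+2.-1.-1]/m -(natrB _ (isT : 0 < m.+2)%N).
congr (_ * _ + _ * _); apply: eq_bigr => i _;
  rewrite -[m.+2%:R]natr1 -[i.+1%:R]natr1; ring.
Qed.
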